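(* Let $r$ be a positive integer with $r \equiv 1 \pmod 4$ and $3 \nmid r$. Then for every integer $k \geq 0$, $(\mathcal{F}_{10,k+rj})_{j=0}^\infty$ is a forward quasi-Fibonacci subsequence; that is, for all $j \in \mathbb{Z}$, $$\mathcal{F}_{10,k+r(j-1)} + \mathcal{F}_{10,k+rj} \equiv \mathcal{F}_{10,k+r(j+1)} \pmod{10}.$$
   Context: The Fibonacci numbers are $F_0=0$, $F_1=1$, $F_n=F_{n-1}+F_{n-2}$, extended to all $n\in\mathbb{Z}$ by the same recurrence. For $n \in \mathbb{Z}$, $\mathcal{F}_{10,n} \in \{0,1,\ldots,9\}$ is the least nonnegative residue of $F_n$ modulo $10$. ''Forward quasi-Fibonacci subsequence'' means exactly that the displayed recurrence holds for all $j\in\mathbb{Z}$. *)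

(* Defs.v *)
From mathcomp Require Import all_boot all_order all_algebra.

Set Implicit Arguments.
Unset Strict Implicit.
Unset Printing Implicit Defensive.

Import Order.TTheory GRing.Theory Num.Theory.
Local Open Scope ring_scope.

(* (F_n, F_{n+1}) |-> (F_{n+1}, F_{n+2})  and  (F_n, F_{n+1}) |-> (F_{n-1}, F_n):
   the recurrence F_n = F_{n-1} + F_{n-2} read in the two directions. *)
Definition fib_next (p : int * int) : int * int := (p.2, p.1 + p.2).
Definition fib_prev (p : int * int) : int * int := (p.2 - p.1, p.1).

Definition fib_pair (n : int) : int * int :=
  match n with
  | Posz m => iter m fib_next (0, 1)
  | Negz m => iter m.+1 fib_prev (0, 1)
  end.

Definition fib (n : int) : int := (fib_pair n).1.

Definition fib10 (n : int) : int := (fib n %% 10)%Z.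

(* The subsequence of fib10 with starting index k and step r; the recurrence is
   required for every integer j, negative ones included. *)
Definition forward_quasi_fibonacci (k r : int) : Prop :=
  forall j : int,
    (fib10 (k + r * (j - 1)) + fib10 (k + r * j)
       = fib10 (k + r * (j + 1)) %[mod 10])%Z.

Lemma fib_prevK : cancel fib_prev fib_next.
Proof. by case=> a b; rewrite /fib_next /fib_prev /= subrK. Qed.

Lemma fib_pairS (n : int) : fib_pair (n + 1) = fib_next (fib_pair n).
Proof.
case: n => [m | [|m]]; first by rewrite -PoszD addn1.
  by rewrite NegzE addNr.
have -> : Negz m.+1 + 1 = Negz m by rewrite !NegzE -addn1 PoszD opprD addrNK.
by rewrite /fib_pair [iter m.+2 _ _]iterS fib_prevK.
Qed.

(* The defining properties of the two-sided Fibonacci sequence. *)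
Lemma fib0 : fib 0 = 0. Proof. by []. Qed.

Lemma fib1 : fib 1 = 1. Proof. by []. Qed.

Lemma fib_rec (n : int) : fib n = fib (n - 1) + fib (n - 2).
Proof.
have -> : n = n - 2 + 1 + 1 by rewrite -addrA subrK.
move: (n - 2) => m; rewrite addrK.
have -> : m + 1 + 1 - 2 = m by rewrite -[m + 1 + 1]addrA addrK.
by rewrite /fib !fib_pairS /= addrC.
Qed.

(* Main.v *)
Require Import Defs.
From mathcomp Require Import all_boot all_order all_algebra.
From mathcomp Require Import zify ring.

Import Order.TTheory GRing.Theory Num.Theory.
Local Open Scope ring_scope.

(** Writing L_s for the Lucas numbers, F_{n+s} + (-1)^s F_{n-s} = L_s F_n, so for
    odd r the quasi-Fibonacci recurrence with step r follows from L_r = 1 mod 10.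
    The Lucas numbers have period 12 modulo 10, the hypotheses on r say that r is
    1 or 5 modulo 12, and L_1 = 1, L_5 = 11. *)

(** Equal to the usual F_{n-1} + F_{n+1}, but written in the basis F_n, F_{n+1} to which [fibD2]
    reduces everything. *)
Definition lucas (n : int) : int := fib (n + 1) *+ 2 - fib n.

Lemma fibD2 (n : int) : fib (n + 2) = fib (n + 1) + fib n.
Proof. by rewrite [LHS]fib_rec; congr (fib _ + fib _); ring. Qed.

Lemma lucasD2 (n : int) : lucas (n + 2) = lucas (n + 1) + lucas n.
Proof.
rewrite /lucas (_ : n + 2 + 1 = n + 1 + 2); last by ring.
rewrite fibD2 (_ : n + 1 + 1 = n + 2); last by ring.
rewrite fibD2; ring.
Qed.

(** For fixed n both sides satisfy x_{s+2} = x_{s+1} + x_s: the sign (-1)^s turns the backward rule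
    F_{n-s-2} = F_{n-s} - F_{n-s-1} into this one. *)
Lemma fibD_add_fibB (n : int) (s : nat) :
  fib (n + s%:Z) + (-1) ^+ s * fib (n - s%:Z) = lucas s%:Z * fib n.
Proof.
elim/ltn_ind: s => -[|[|s]] IH.
- have -> : lucas 0 = 2 by [].
  rewrite oppr0 addr0; ring.
- have := fibD2 (n - 1).
  have -> : n - 1 + 2 = n + 1 by ring.
  rewrite subrK => ->; have -> : lucas 1 = 1 by [].
  ring.
have := IH s.+1 (ltnSn _); have := IH s (leqW (ltnSn _)).
have -> : s.+2%:Z = s%:Z + 2 by lia.
have -> : s.+1%:Z = s%:Z + 1 by lia.
rewrite lucasD2 (mulrDl (lucas _)) => <- <-.
have := fibD2 (n - (s%:Z + 2)).
have -> : n - (s%:Z + 2) + 2 = n - s%:Z by ring.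
have -> : n - (s%:Z + 2) + 1 = n - (s%:Z + 1) by ring.
rewrite [n + (s%:Z + 2)]addrA fibD2 !addrA !exprS => ->.
ring.
Qed.

(** Twelve steps of the recurrence give 89 L_n + 144 L_{n+1}; the excess 88 L_n + 144 L_{n+1} over
    L_n is 200 F_n + 320 F_{n+1}. *)
Lemma lucasD12 (n : int) :
  lucas (n + 12) = lucas n + 10 * (20 * fib n + 32 * fib (n + 1)).
Proof.
have shift m : lucas (n + m.+2%:Z) = lucas (n + m.+1%:Z) + lucas (n + m%:Z).
  have -> : n + m.+2%:Z = n + m%:Z + 2 by lia.
  by rewrite lucasD2; congr (lucas _ + _); lia.
rewrite !shift addr0 /lucas (_ : n + 1 + 1 = n + 2); last by ring.
rewrite fibD2; ring.
Qed.

Lemma lucas_mod10_period (m q : nat) :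
  (lucas (m + 12 * q)%N = lucas m %[mod 10])%Z.
Proof.
elim: q => [|q IHq]; first by rewrite muln0 addn0.
have -> : (m + 12 * q.+1)%N%:Z = (m + 12 * q)%N%:Z + 12 by lia.
by rewrite lucasD12 addrC mulrC modzMDl.
Qed.

Theorem theorem4p7 (r : int) (hr_pos : 0 < r) (hr_mod4 : (r = 1 %[mod 4])%Z)
    (hr_3 : ~~ (3 %| r)%Z) (k : int) (hk : 0 <= k) :
  forward_quasi_fibonacci k r.
Proof.
case: r hr_pos hr_mod4 hr_3 => // s _ s_mod4 s_mod3 j.
have odd_s : odd s by lia.
have lucas_s : (lucas s = 1 %[mod 10])%Z.
  (* Of the residues 1, 5, 9 modulo 12 allowed by [s_mod4], [s_mod3] removes 9. *)
  have [q [->|->]] : exists q, s = (1 + 12 * q)%N \/ s = (5 + 12 * q)%N.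
    by exists (s %/ 12)%N; lia.
  - by rewrite lucas_mod10_period.
  - by rewrite lucas_mod10_period.
have := fibD_add_fibB (k + s%:Z * j) s.
rewrite -signr_odd odd_s expr1 mulN1r.
have -> : k + s%:Z * j + s%:Z = k + s%:Z * (j + 1) by ring.
have -> : k + s%:Z * j - s%:Z = k + s%:Z * (j - 1) by ring.
(* Solve the identity for the term at j + 1, so that L_s can be replaced by 1 modulo 10. *)
rewrite /fib10 modzDm modz_mod => /(canRL (subrK _)) ->.
by rewrite -[RHS]modzDml -modzMml lucas_s modzMml mul1r modzDml addrC.
Qed.
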